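(* Fix $0<\mu\le 2$ and let $\{G_t:t\ge1\}$ be the random graph process with parameter $\mu$, with giant component $C_t$. Then for any small enough $\nu>0$, $$\mathbb{E}(|C_t|)=(1-e^{-\mu})\,t+O\!\left(t^{\frac{1}{2-\nu}}\right),$$ where the hidden constant in $O(t^{\frac{1}{2-\nu}})$ depends only on $\nu$.
   Context: Here $u\wedge v=\min(u,v)$. For a parameter $\mu>0$, the random graph process $\{G_t=(V_t,E_t):t\ge1\}$ is defined as follows. Time-Step 1: $G_1$ consists of two vertices $x_0,x_1$ and the edge $\langle x_0,x_1\rangle$. Time-Step $t\ge 2$: a new vertex $x_t$ is added to $G_{t-1}$, and then random edges incident with $x_t$ are added: given $G_{t-1}$, for each $0\le i\le t-1$ the edge $\langle x_i,x_t\rangle$ is added independently with probability $\frac{\mu\, d_{x_i}(t-1)}{2e_{t-1}}\wedge 1$, where $d_{x_i}(t-1)$ is the degree of $x_i$ in $G_{t-1}$ and $e_{t-1}=|E_{t-1}|$. Thus $V_t=\{x_0,\dots,x_t\}$. By construction, apart from isolated vertices, $G_t$ has a unique connected component; it is called the giant component of $G_t$ and denoted $C_t$. $|C_t|$ is its number of vertices. *)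

(* Defs.v *)
From HB Require Import structures.
From mathcomp Require Import all_boot all_order all_algebra.

Set Implicit Arguments.
Unset Strict Implicit.
Unset Printing Implicit Defensive.

Import Order.TTheory GRing.Theory Num.Theory.

(* A graph on the vertices x_0, ..., x_(n-1) is given by its edge set, an edge
   <x_i, x_j> being the pair set [set i; j]. *)
Definition graph (n : nat) := {set {set 'I_n}}.

Definition degree n (E : graph n) (i : 'I_n) : nat := #|[set e in E | i \in e]|.

Definition adj n (E : graph n) : rel 'I_n :=
  fun i j => (i != j) && ([set i; j] \in E).

Definition components n (E : graph n) : {set {set 'I_n}} :=
  equivalence_partition (connect (adj E)) [set: 'I_n].

(* Almost surely, G_t has exactly one component that is not an isolated vertex,
   so that the choice made by pick is immaterial. *)
Definition giant n (E : graph n) : {set 'I_n} :=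
  odflt set0 [pick C in components E | 1 < #|C|].

Definition single_edge : graph 2 := [set [set ord0; ord_max]].

(* The graph E on x_0, ..., x_(n-1) extended with the vertex x_n, whose
   neighbours are the x_i with i in S. *)
Definition add_vertex n (E : graph n) (S : {set 'I_n}) : graph n.+1 :=
  [set widen_ord (leqnSn n) @: (e : {set 'I_n}) | e in E]
    :|: [set [set widen_ord (leqnSn n) i; ord_max] | i in S].

From mathcomp Require Import all_classical all_reals all_analysis.

Local Open Scope ring_scope.

Definition attach_prob (R : realType) (mu : R) n (E : graph n) (i : 'I_n) : R :=
  Num.min (mu * (degree E i)%:R / (2 * #|E|%:R)) 1.

Local Open Scope classical_set_scope.

(* The value G 0 is irrelevant.  The last clause says that, given G_t, the edges
   <x_i, x_(t+1)> are present independently with probability attach_prob mu G_t i,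
   in the form of the joint law of G_t and of the neighbourhood of x_(t+1);
   G_t determines G_1, ..., G_(t-1), as these are its induced subgraphs. *)
Record graph_process (R : realType) (d : measure_display) (T : measurableType d)
    (P : probability T R) (mu : R) (G : forall t : nat, T -> graph t.+1) : Prop :=
  GraphProcess {
    graph_process_measurable : forall (t : nat) (E : graph t.+1), (1 <= t)%N ->
      measurable [set w | G t w = E];
    graph_process_start : forall w : T, G 1%N w = single_edge;
    graph_process_step : forall (t : nat) (w : T), (1 <= t)%N ->
      exists S : {set 'I_t.+1}, G t.+1 w = add_vertex (G t w) S;
    graph_process_law : forall (t : nat) (E : graph t.+1) (S : {set 'I_t.+1}),
      (1 <= t)%N ->
      (P [set w | G t w = E /\ G t.+1 w = add_vertex E S] =
       P [set w | G t w = E] *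
       (\prod_(i < t.+1) (if i \in S then attach_prob mu E i
                          else 1 - attach_prob mu E i))%:E)%E
  }.

(* Main.v *)
Require Import Defs.
From HB Require Import structures.
From mathcomp Require Import all_boot all_order all_algebra.
From mathcomp Require Import all_classical all_reals all_analysis.
From mathcomp Require Import measurable_realfun.
From mathcomp Require Import zify ring lra.

Set Implicit Arguments.
Unset Strict Implicit.
Unset Printing Implicit Defensive.

Import Order.TTheory GRing.Theory Num.Theory.
Local Open Scope ring_scope.

(** Write e for the number of edges of the current graph, Q for the sum of the
    squares of its degrees, and p_i for the probability that the next vertex is
    attached to x_i.  Three facts about the model carry everything.

    - As mu <= 2 and no degree exceeds e, the truncation at 1 is never active:
      p_i = mu d_i / (2 e), and the p_i sum to exactly mu.
    - Isolated vertices have p_i = 0, so they stay isolated, and the giant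
      component is the set of all nonisolated vertices
      ([giant_nonisolated], [grown_graph_as]).  Hence one step adds 1 to its size
      unless the new vertex receives no edge, which has probability
      prod_i (1 - p_i).
    - This product differs from exp (- mu) by at most
      sum_i p_i^2 = mu^2 Q / (4 e^2) ([abs_isolation_prob_le]).

    The error in E|C_t| is thus O(1) plus a sum over s < t of
    mu^2 E[Q_s / (4 e_s^2)], and the point is to bound this sum by a multiple of
    sqrt t.  No concentration of e_s is needed: the function
    W = Q e^(-3/2) + 264 e^(-1/2) is a supermartingale with an explicit gain,
    E[W_(s+1) | G_s] <= W_s - (mu / 2) Q_s e_s^(-5/2) ([potential_drift]).
    Indeed Q grows at relative rate mu / e while e^(-3/2) decays at relative rate
    3 mu / (2 e); the lower order terms, of size mu e^(-3/2), are absorbed by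
    the decay of 264 e^(-1/2).  Consequently E[Q_s e_s^(-3/2)] is bounded, and the
    sum over all s of mu E[Q_s e_s^(-5/2)] is bounded as well, uniformly in mu.
    By the inequality of arithmetic and geometric means,
    e^(-2) <= sqrt t e^(-5/2) + e^(-3/2) / sqrt t, so the sum over s < t of
    mu^2 E[Q_s / e_s^2] is O(sqrt t).  Finally sqrt t <= t^(1 / (2 - nu)) for
    0 < nu < 1. *)

(** * Real inequalities *)

Section RealInequalities.
Variable R : realType.
Implicit Types x e N : R.

Lemma expRN_le_inv x : 0 <= x -> expR (- x) <= (1 + x)^-1.
Proof.
move=> x0; rewrite expRN lef_pV2 ?posrE ?expR_gt0 ?expR_ge1Dx //.
by rewrite ltr_pwDl.
Qed.

Lemma expRN_le_quadratic x : 0 <= x -> expR (- x) <= 1 - x + x ^+ 2.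
Proof.
move=> x0; apply: (le_trans (expRN_le_inv x0)).
rewrite -[leLHS]mul1r ler_pdivrMr ?ltr_pwDl //.
have: 0 <= x ^+ 3 by rewrite exprn_ge0.
by lra.
Qed.

(** The coefficient 3, where the Taylor coefficient is 15/8, makes the bound hold
    for all N >= 0: in z = sqrt (1 + N / e) - 1, the difference of the two sides is
    a polynomial with nonnegative coefficients, up to a positive factor. *)
Lemma invr_sqrt3_add_le e N : 0 < e -> 0 <= N ->
  (Num.sqrt (e + N))^-1 ^+ 3 <=
  (Num.sqrt e)^-1 ^+ 3 * (1 - 3 / 2 * (N / e) + 3 * (N / e) ^+ 2).
Proof.
move=> e0 N0.
have r0 : 0 < Num.sqrt e by rewrite sqrtr_gt0.
have x0 : 0 <= N / e by rewrite divr_ge0 // ltW.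
have -> : e + N = e * (1 + N / e) by field; lra.
rewrite sqrtrM ?(ltW e0) // invfM exprMn ler_pM2l ?exprn_gt0 ?invr_gt0 //.
set x := N / e in x0 *.
have y1 : 1 <= Num.sqrt (1 + x).
  by rewrite -[leLHS]sqrtr1 ler_wsqrtr // lerDl.
have yE : x = Num.sqrt (1 + x) ^+ 2 - 1.
  by rewrite sqr_sqrtr ?addr_ge0 //; ring.
rewrite {2 3}yE; set y := Num.sqrt _ in y1 *.
rewrite exprVn -[leLHS]mul1r ler_pdivrMr ?exprn_gt0 ?(lt_le_trans _ y1) //.
have [z z0 ->] : exists2 z, 0 <= z & y = 1 + z.
  by exists (y - 1); [rewrite subr_ge0 | ring].
have pz (m : nat) : 0 <= z ^+ m by rewrite exprn_ge0.
rewrite -subr_ge0.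
have -> : (1 - 3 / 2 * ((1 + z) ^+ 2 - 1) + 3 * ((1 + z) ^+ 2 - 1) ^+ 2)
    * (1 + z) ^+ 3 - 1 = 9 / 2 * z ^+ 2 + 71 / 2 * z ^+ 3 + 135 / 2 * z ^+ 4
    + 111 / 2 * z ^+ 5 + 21 * z ^+ 6 + 3 * z ^+ 7 by field.
move: (pz 2%N) (pz 3%N) (pz 4%N) (pz 5%N) (pz 6%N) (pz 7%N); lra.
Qed.

(** A single new edge already lowers e^(-1/2) by a fixed multiple of e^(-3/2),
    even when e is so small that a Taylor expansion says nothing. *)
Lemma invr_sqrt_add_le e N : 1 <= e -> 1 <= N ->
  (Num.sqrt (e + N))^-1 <= (Num.sqrt e)^-1 - (Num.sqrt e)^-1 ^+ 3 / 4.
Proof.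
move=> e1 N1.
set a := Num.sqrt e; set b := Num.sqrt (e + N).
have a1 : 1 <= a by rewrite -[leLHS]sqrtr1 ler_wsqrtr.
have a0 : 0 < a by lra.
have aE : a ^+ 2 = e by rewrite sqr_sqrtr //; lra.
have bE : b ^+ 2 = e + N by rewrite sqr_sqrtr //; lra.
have b0 : 0 < b by rewrite sqrtr_gt0; lra.
have a2 : 1 <= a ^+ 2 by rewrite aE.
have -> : a^-1 - a^-1 ^+ 3 / 4 = (4 * a ^+ 2 - 1) / (4 * a ^+ 3).
  by field; lra.
have a3 : 0 < a ^+ 3 by rewrite exprn_gt0.
rewrite ler_pdivlMr ?mulr_gt0 // mulrC ler_pdivrMr //.
(* After clearing denominators, squaring removes the remaining root b. *)
rewrite -ler_sqr ?nnegrE; last 2 first.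
- by rewrite mulr_ge0 // ltW.
- by rewrite mulr_ge0 ?(ltW b0) //; lra.
rewrite [leRHS]exprMn bE.
have [z z0 eE] : exists2 z, 0 <= z & e = 1 + z by exists (e - 1); [lra|ring].
have -> : (4 * a ^+ 3) ^+ 2 = 16 * (a ^+ 2) ^+ 3 by ring.
rewrite aE eE.
apply: (@le_trans _ _ ((4 * (1 + z) - 1) ^+ 2 * ((1 + z) + 1))); last first.
  by rewrite ler_wpM2l ?sqr_ge0 // lerD2l.
rewrite -subr_ge0 (_ : _ - _ = 8 * z ^+ 2 + 9 * z + 2); last by ring.
by have := sqr_ge0 z; lra.
Qed.

End RealInequalities.

(** * Random subsets with independent memberships *)

Section RandomSubset.
Variables (R : realType) (I : finType).
Implicit Types (p : I -> R) (S A : {set I}).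

Definition subset_prob p S : R := \prod_i (if i \in S then p i else 1 - p i).

Lemma subset_prob_ge0 p S : (forall i, 0 <= p i <= 1) -> 0 <= subset_prob p S.
Proof.
by move=> p01; apply: prodr_ge0 => i _; have := p01 i; case: ifP => _; lra.
Qed.

(** All moments below come from these inclusion probabilities.  Multiplying the
    weight of an absent i in A by 0 turns the restriction to supersets of A into
    another product weight, and such weights sum to a product by distributivity. *)
Lemma sum_subset_prob_superset p A :
  \sum_S subset_prob p S * (A \subset S)%:R = \prod_(i in A) p i.
Proof.
transitivity (\prod_i (p i + (1 - p i) * (i \notin A)%:R)).
  rewrite bigA_distr; apply: eq_bigr => S _; rewrite /subset_prob.
  have [/fintype.subsetP AS|] := boolP (A \subset S).
    rewrite mulr1; apply: eq_bigr => i _; case: ifPn => // iS.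
    by rewrite (contra (AS i)) // mulr1.
  rewrite mulr0 => /fintype.subsetPn[i iA iS].
  by rewrite (bigD1 i) //= (negbTE iS) iA mulr0 mul0r.
rewrite [RHS]big_mkcond; apply: eq_bigr => i _.
by case: (i \in A) => /=; ring.
Qed.

Lemma sum_subset_prob p : \sum_S subset_prob p S = 1.
Proof.
have := sum_subset_prob_superset p finset.set0.
rewrite big_set0 => <-.
by apply: eq_bigr => S _; rewrite finset.sub0set mulr1.
Qed.

Lemma mean_subset_sum p (a : I -> R) :
  \sum_S subset_prob p S * (\sum_(i in S) a i) = \sum_i p i * a i.
Proof.
transitivity (\sum_S \sum_i (subset_prob p S * ([set i] \subset S)%:R) * a i).
  apply: eq_bigr => S _; rewrite big_mkcond mulr_sumr; apply: eq_bigr => i _.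
  by rewrite finset.sub1set; case: (i \in S); rewrite ?(mulr1, mulr0, mul0r).
rewrite exchange_big; apply: eq_bigr => i _.
by rewrite -mulr_suml sum_subset_prob_superset big_set1.
Qed.

Lemma mean_subset_card p : \sum_S subset_prob p S * #|S|%:R = \sum_i p i.
Proof.
rewrite -[RHS](eq_bigr _ (fun i _ => mulr1 (p i))) -mean_subset_sum.
by apply: eq_bigr => S _; rewrite sumr_const.
Qed.

(** |S|^2 counts the pairs (i, j) with both entries in S.  Off the diagonal a pair
    has probability p i * p j; the diagonal contributes the first sum. *)
Lemma mean_subset_card_sqr p : (forall i, 0 <= p i <= 1) ->
  \sum_S subset_prob p S * #|S|%:R ^+ 2 <= \sum_i p i + (\sum_i p i) ^+ 2.
Proof.
move=> p01.
have cardE S : #|S|%:R ^+ 2 = \sum_i \sum_j ([set i; j] \subset S)%:R :> R.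
  rewrite expr2 -sum1_card natr_sum  mulr_suml big_mkcond.
  apply: eq_bigr => i _; rewrite mulr_sumr big_mkcond /=.
  case: ifP => iS; last first.
    by rewrite big1 // => j _; rewrite finset.subUset !finset.sub1set iS.
  apply: eq_bigr => j _; rewrite finset.subUset !finset.sub1set iS /=.
  by case: (j \in S); rewrite ?mulr1.
have -> : \sum_S subset_prob p S * #|S|%:R ^+ 2 =
    \sum_i \sum_j \prod_(k in [set i; j]) p k.
  under eq_bigr do rewrite cardE mulr_sumr.
  rewrite exchange_big; apply: eq_bigr => i _.
  under eq_bigr do rewrite mulr_sumr.
  rewrite exchange_big; apply: eq_bigr => j _.
  exact: sum_subset_prob_superset.
have -> : \sum_i p i + (\sum_i p i) ^+ 2 =
    \sum_i \sum_j ((i == j)%:R * p i + p i * p j).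
  rewrite expr2 mulr_suml -big_split; apply: eq_bigr => i _ /=.
  rewrite big_split mulr_sumr; congr (_ + _).
  rewrite -mulr_suml (bigD1 i) //= eqxx big1 ?addr0 ?mul1r // => j.
  by rewrite eq_sym => /negbTE ->.
apply: ler_sum => i _; apply: ler_sum => j _.
have /andP[pi0 _] := p01 i; have /andP[pj0 _] := p01 j.
have [->|ij] := eqVneq i j.
  by rewrite finset.setUid big_set1 mul1r lerDl mulr_ge0.
by rewrite mul0r add0r big_setU1 ?inE // big_set1.
Qed.


End RandomSubset.
(** * Products of complementary probabilities *)

Section ProductBounds.
Variables (R : realType) (I : Type) (r : seq I) (p : I -> R).
Hypothesis p01 : forall i, 0 <= p i <= 1.

Let onem01 i : 0 <= 1 - p i <= 1.
Proof. by have := p01 i; lra. Qed.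

Lemma prod_onem_le_expR : \prod_(i <- r) (1 - p i) <= expR (- \sum_(i <- r) p i).
Proof.
rewrite -sumrN expR_sum; apply: ler_prod => i _.
by have /andP[-> _] := onem01 i; exact: expR_ge1Dx.
Qed.

(** Factors in [0, 1] are exchanged one at a time, and exchanging expR (- p i) for
    1 - p i costs at most p i ^+ 2. *)
Lemma expR_sub_prod_onem_le :
  expR (- \sum_(i <- r) p i) - \prod_(i <- r) (1 - p i) <= \sum_(i <- r) p i ^+ 2.
Proof.
elim: r => [|i s IHs]; first by rewrite !big_nil oppr0 expR0 subrr.
rewrite !big_cons opprD expRD.
set b := expR (- \sum_(j <- s) p j) in IHs *; set d := \prod_(j <- s) _ in IHs *.
set V := \sum_(j <- s) p j ^+ 2 in IHs *.
have b0 : 0 <= b by exact: expR_ge0.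
have b1 : b <= 1.
  by rewrite -expR0 ler_expR oppr_le0 sumr_ge0 // => j _; have /andP[] := p01 j.
have V0 : 0 <= V by rewrite sumr_ge0 // => j _; exact: sqr_ge0.
have /andP[p0 p1] := p01 i.
have a1 : expR (- p i) - (1 - p i) <= p i ^+ 2.
  by have := expRN_le_quadratic p0; lra.
rewrite (_ : _ - _ = (expR (- p i) - (1 - p i)) * b + (1 - p i) * (b - d)); last first.
  by ring.
apply: lerD.
  apply: (le_trans (ler_wpM2r b0 a1)).
  by rewrite ler_piMr // sqr_ge0.
apply: (@le_trans _ _ ((1 - p i) * V)); first by rewrite ler_wpM2l //; lra.
by rewrite ler_piMl //; lra.
Qed.

End ProductBounds.

(** * Growth of the graph *)

Section GraphGrowth.
Local Open Scope nat_scope.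

Definition nonisolated n (E : graph n) : {set 'I_n} :=
  [set i | 0 < degree E i].

(** The almost sure invariants of the process: they hold for a single edge and
    survive the addition of a vertex attached to nonisolated vertices. *)
Record grown_graph n (E : graph n) : Prop := GrownGraph {
  grown_card_gt0 : 0 < #|E|;
  grown_handshake : \sum_i degree E i = 2 * #|E|;
  grown_nonisolated : 1 < #|nonisolated E|;
  grown_connect : {in nonisolated E &, forall i j, connect (adj E) i j} }.

Lemma adj_sym n (E : graph n) : symmetric (adj E).
Proof. by move=> i j; rewrite /adj eq_sym finset.setUC. Qed.

Lemma connect_adj_sym n (E : graph n) : connect_sym (adj E).
Proof. exact/sym_connect_sym/adj_sym. Qed.

Lemma adj_nonisolated n (E : graph n) i j : adj E i j -> i \in nonisolated E.
Proof.
case/andP=> _ ijE; rewrite inE; apply/card_gt0P; exists [set i; j]%SET.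
by rewrite inE ijE !inE eqxx.
Qed.

Lemma connect_nonisolated n (E : graph n) i j :
  connect (adj E) i j -> i != j -> i \in nonisolated E.
Proof.
case/connectP=> [[|k p] /=]; first by move=> _ ->; rewrite eqxx.
by case/andP=> /adj_nonisolated.
Qed.

(** Connectedness makes the nonisolated vertices a class of the partition, and any
    class with two elements contains a nonisolated vertex, so the choice made in
    [giant] is forced. *)
Lemma giant_nonisolated n (E : graph n) : grown_graph E -> giant E = nonisolated E.
Proof.
case=> _ _ E_gt1 EC.
have classE i : i \in nonisolated E ->
    [set j in [set: 'I_n] | connect (adj E) i j]%SET = nonisolated E.
  move=> iE; apply/setP=> j; rewrite !inE /=.
  apply/idP/idP=> [ij|jE]; last by apply: EC => //; rewrite inE.
  have [<-|nij] := eqVneq i j; first by rewrite inE in iE.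
  have : j \in nonisolated E.
    by apply: (@connect_nonisolated _ _ j i); rewrite 1?connect_adj_sym // eq_sym.
  by rewrite inE.
rewrite /giant; case: pickP => [C /andP[/imsetP[i _ ->]] C_gt1 | noC] /=.
  apply: classE; move: C_gt1; rewrite (cardD1 i).
  have -> : i \in [set j in [set: 'I_n] | connect (adj E) i j]%SET.
    by rewrite !inE connect0.
  rewrite ltnS => /card_gt0P[j]; rewrite !inE => /andP[nji /= ij].
  suff : i \in nonisolated E by rewrite inE.
  by apply: (connect_nonisolated ij); rewrite eq_sym.
have /card_gt0P[i iE] := ltnW E_gt1.
have := noC (nonisolated E); rewrite E_gt1 andbT => /negP[].
by apply/imsetP; exists i; rewrite ?inE // classE.
Qed.

Section AddVertex.
Variables (n : nat) (E : graph n) (S : {set 'I_n}).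
Let old : 'I_n -> 'I_n.+1 := widen_ord (leqnSn n).
Let E' : graph n.+1 := add_vertex E S.

Let old_inj : injective old.
Proof. by move=> i j /(congr1 val) /= ?; apply: val_inj. Qed.

Let old_neq_max i : (old i == ord_max) = false.
Proof. by apply/negbTE; rewrite neq_ltn /= ltn_ord. Qed.

Let max_notin_old (e : {set 'I_n}) : (ord_max \in old @: e) = false.
Proof. by apply/imsetP=> -[i _ /esym/eqP]; rewrite old_neq_max. Qed.

(** The edge count and all degrees of the enlarged graph are instances, for
    suitable Q: old edges avoid the new vertex, new ones contain it, and both
    kinds are indexed injectively. *)
Lemma card_add_vertex_filter (Q : pred {set 'I_n.+1}) :
  #|[set e in E' | Q e]%SET| =
  #|[set e in E | Q (old @: (e : {set 'I_n}))]%SET|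
  + #|[set i in S | Q [set old i; ord_max]]%SET|.
Proof.
pose new i := [set old i; ord_max]%SET.
have new_inj : injective new.
  move=> i j /setP/(_ (old i)); rewrite !inE eqxx old_neq_max !orbF.
  by rewrite (inj_eq old_inj) => /esym/eqP.
have lift_inj : injective (fun e : {set 'I_n} => old @: e) by exact: imset_inj.
rewrite -(card_imset _ lift_inj) -(card_imset _ new_inj).
set A := imset _ _; set B := imset new _.
have -> : [set e in E' | Q e]%SET = (A :|: B)%SET.
  apply/setP=> e; rewrite !inE; apply/andP/orP.
    case=> /orP[/imsetP[f fE ->]|/imsetP[i iS ->]] Qe.
      by left; apply/imsetP; exists f; rewrite // inE fE.
    by right; apply/imsetP; exists i; rewrite // inE iS.
  case=> /imsetP[x]; rewrite inE => /andP[xE Qx] ->; split=> //; apply/orP.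
    by left; apply/imsetP; exists x.
  by right; apply/imsetP; exists x.
rewrite cardsU [X in _ - X]eq_card0 ?subn0 // => e; rewrite !inE.
apply/andP=> -[/imsetP[f _ ->]] /imsetP[i _ /setP/(_ ord_max)].
by rewrite !inE eqxx orbT max_notin_old.
Qed.

Lemma card_add_vertex : #|E'| = #|E| + #|S|.
Proof.
have := card_add_vertex_filter predT.
by rewrite /= !finset.setIdE !finset.setIT.
Qed.

Lemma degree_add_vertex_old i : degree E' (old i) = degree E i + (i \in S).
Proof.
rewrite /degree card_add_vertex_filter; congr (_ + _).
  by apply: eq_card => e; rewrite !inE mem_imset.
have -> : [set j in S | old i \in [set old j; ord_max]]%SET = S :&: [set i].
  by apply/setP=> j; rewrite !inE old_neq_max orbF (inj_eq old_inj) eq_sym.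
have [iS|iS] := boolP (i \in S).
  have /finset.setIidPr -> : [set i]%SET \subset S by rewrite finset.sub1set.
  by rewrite cards1.
apply: eq_card0 => j; rewrite !inE.
by case: eqP => [->|]; rewrite ?(negbTE iS) ?andbF.
Qed.

Lemma degree_add_vertex_max : degree E' ord_max = #|S|.
Proof.
rewrite /degree card_add_vertex_filter eq_card0 => [|e]; last first.
  by rewrite !inE max_notin_old andbF.
by apply: eq_card => i; rewrite !inE eqxx orbT andbT.
Qed.

Hypothesis gE : grown_graph E.
Hypothesis SE : S \subset nonisolated E.

Let memS i : i \in S -> 0 < degree E i.
Proof. by move/(fintype.subsetP SE); rewrite inE. Qed.

Lemma card_nonisolated_add_vertex :
  #|nonisolated E'| = #|nonisolated E| + (S != finset.set0).
Proof.
have cardE m (F : graph m) : #|nonisolated F| = \sum_i (0 < degree F i).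
  by rewrite /nonisolated -sum1dep_card big_mkcond.
rewrite !cardE big_ord_recr /=; congr (_ + _).
  apply: eq_bigr => i _; rewrite -/(old i) degree_add_vertex_old.
  by have [/memS|] := boolP (i \in S); rewrite ?addn0 // addn1 /= => ->.
by rewrite degree_add_vertex_max -card_gt0.
Qed.

Let old_adj i j : adj E i j -> adj E' (old i) (old j).
Proof.
case/andP=> ij ijE; apply/andP; split; first by rewrite (inj_eq old_inj).
rewrite inE; apply/orP; left; apply/imsetP; exists [set i; j]%SET => //.
by rewrite imsetU !imset_set1.
Qed.

Let old_connect i j : connect (adj E) i j -> connect (adj E') (old i) (old j).
Proof.
case/connectP=> p; elim: p i => [|k p IHp] i /=; first by move=> _ ->.
case/andP=> ik kp jE; apply: (connect_trans (connect1 (old_adj ik))).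
exact: IHp.
Qed.

Lemma grown_add_vertex : grown_graph E'.
Proof.
have [E0 hand E1 EC] := gE.
have ord_case (j : 'I_n.+1) : j = ord_max \/ exists i, j = old i.
  have [jn|jn] := ltnP j n; [right|left].
    by exists (Ordinal jn); apply: val_inj.
  by apply/val_inj/anti_leq; rewrite jn -ltnS ltn_ord.
have oldE i : old i \in nonisolated E' -> i \in nonisolated E.
  rewrite !inE degree_add_vertex_old.
  by have [/memS|] := boolP (i \in S); rewrite ?addn0.
have maxC i : i \in nonisolated E -> ord_max \in nonisolated E' ->
    connect (adj E') (old i) ord_max.
  move=> iE; rewrite inE degree_add_vertex_max => /card_gt0P[s sS].
  apply: (@connect_trans _ _ (old s)).
    by apply/old_connect/EC => //; rewrite inE memS.
  apply: connect1; rewrite /adj old_neq_max /= inE; apply/orP; right.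
  by apply/imsetP; exists s.
split.
- by rewrite card_add_vertex ltn_addr.
- rewrite big_ord_recr /= degree_add_vertex_max.
  under eq_bigr do rewrite -/(old _) degree_add_vertex_old.
  rewrite big_split /= hand card_add_vertex.
  have -> : \sum_i (i \in S) = #|S|.
    by rewrite -sum1_card [RHS]big_mkcond.
  by rewrite mulnDr -addnA addnn -mul2n.
- by rewrite card_nonisolated_add_vertex ltn_addr.
- move=> j k; have [->|[i ->]] := ord_case j; have [->|[l ->]] := ord_case k.
  + by move=> _ _; exact: connect0.
  + by move=> maxE /oldE lE; rewrite connect_adj_sym; exact: maxC.
  + by move=> /oldE iE; exact: maxC.
  + by move=> /oldE iE /oldE lE; apply/old_connect/EC.
Qed.

End AddVertex.

(** The degrees of the old vertices reveal who is attached to the new one. *)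
Lemma add_vertex_inj n (E : graph n) : injective (add_vertex E).
Proof.
move=> S S' SS'; apply/setP=> i; have := degree_add_vertex_old E S i.
by rewrite SS' degree_add_vertex_old => /addnI; do 2![case: (_ \in _)].
Qed.

Lemma degree_single_edge i : degree single_edge i = 1.
Proof.
have -> : degree single_edge i = #|[set [set ord0; ord_max]%SET : {set 'I_2}]%SET|.
  apply: eq_card => e; rewrite !inE; case: eqP => //= ->; rewrite !inE.
  by case: i => -[|[|]].
by rewrite cards1.
Qed.

Lemma nonisolated_single_edge : nonisolated single_edge = [set: 'I_2]%SET.
Proof. by apply/setP=> i; rewrite !inE degree_single_edge. Qed.

Lemma grown_single_edge : grown_graph single_edge.
Proof.
split; rewrite ?nonisolated_single_edge ?cards1 ?cardsT ?card_ord //.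
  by under eq_bigr do rewrite degree_single_edge; rewrite sum1_card card_ord.
have edge : connect (adj single_edge) ord0 ord_max by rewrite connect1 // /adj !inE eqxx.
move=> i j _ _; have I2 (k : 'I_2) : k = ord0 \/ k = ord_max.
  by case: k => -[|[|]] // ?; [left|right]; apply: val_inj.
have [->|->] := I2 i; have [->|->] := I2 j; rewrite ?connect0 //.
by rewrite connect_adj_sym.
Qed.

Lemma degree_le_card n (E : graph n) i : degree E i <= #|E|.
Proof. by apply/subset_leq_card/fintype.subsetP=> e; rewrite inE => /andP[]. Qed.

(** Each degree is at most the number of edges, and the degrees sum to twice that
    number. *)
Lemma sum_degree_sqr_le n (E : graph n) : grown_graph E ->
  \sum_i degree E i ^ 2 <= 2 * #|E| ^ 2.
Proof.
move=> [_ hand _ _]; rewrite !expnS expn0 muln1 mulnA -hand big_distrl /=.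
by apply: leq_sum => i _; rewrite expnS expn1 leq_mul2l degree_le_card orbT.
Qed.

Lemma sum_degree_sqr_add_vertex n (E : graph n) (S : {set 'I_n}) :
  \sum_i degree (add_vertex E S) i ^ 2 =
  \sum_i degree E i ^ 2 + \sum_(i in S) (2 * degree E i + 1) + #|S| ^ 2.
Proof.
rewrite big_ord_recr /= degree_add_vertex_max [X in _ + X + _]big_mkcond.
rewrite -big_split; congr (_ + _); apply: eq_bigr => i _.
rewrite degree_add_vertex_old /=; case: (i \in S); last by rewrite !addn0.
by rewrite sqrnD muln1; lia.
Qed.

End GraphGrowth.

(** * One step of the process: a supermartingale *)

Section Drift.
Variable R : realType.

Definition sum_sqr_degree n (E : graph n) : R := (\sum_i degree E i ^ 2)%N%:R.

Definition inv_sqrt_edges n (E : graph n) : R := (Num.sqrt #|E|%:R)^-1.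

(** The weight 264 = 12 * 22 is what makes the decay of the second term absorb, in
    [potential_drift], the terms of order mu e^(-3/2), whose total coefficient is
    at most 22. *)
Definition potential n (E : graph n) : R :=
  sum_sqr_degree E * inv_sqrt_edges E ^+ 3 + 264 * inv_sqrt_edges E.

Lemma sum_sqr_degree_ge0 n (E : graph n) : 0 <= sum_sqr_degree E.
Proof. exact: ler0n. Qed.

Lemma inv_sqrt_edges_ge0 n (E : graph n) : 0 <= inv_sqrt_edges E.
Proof. by rewrite invr_ge0 sqrtr_ge0. Qed.

Lemma potential_ge0 n (E : graph n) : 0 <= potential E.
Proof.
by rewrite addr_ge0 ?mulr_ge0 ?ler0n ?exprn_ge0 ?inv_sqrt_edges_ge0.
Qed.

Lemma inv_sqrt_edges_sqr n (E : graph n) : inv_sqrt_edges E ^+ 2 = #|E|%:R^-1.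
Proof. by rewrite exprVn sqr_sqrtr. Qed.

Variables (mu : R) (n : nat) (E : graph n).
Hypotheses (mu_gt0 : 0 < mu) (mu_le2 : mu <= 2) (gE : grown_graph E).

Let e : R := #|E|%:R.
Let Q : R := sum_sqr_degree E.
Let v : R := inv_sqrt_edges E.
Let p : 'I_n -> R := attach_prob mu E.

Let e_ge1 : 1 <= e.
Proof. by rewrite ler1n; case: gE. Qed.

Let e_gt0 : 0 < e.
Proof. exact: lt_le_trans e_ge1. Qed.

Let handshakeR : \sum_i (degree E i)%:R = 2 * e.
Proof. by rewrite -natr_sum (grown_handshake gE) natrM. Qed.

Let sqr_degreeE : Q = \sum_i (degree E i)%:R ^+ 2.
Proof. by rewrite /Q /sum_sqr_degree natr_sum; under eq_bigr do rewrite natrX. Qed.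

(** Since degrees are at most e, the ratio mu d / (2 e) is at most mu / 2 <= 1:
    the probability is never truncated. *)
Lemma attach_probE i : attach_prob mu E i = mu / (2 * e) * (degree E i)%:R.
Proof.
rewrite mulrAC; apply/min_idPl.
have de : (degree E i)%:R <= e by rewrite ler_nat degree_le_card.
rewrite ler_pdivrMr ?mulr_gt0 // mul1r.
by apply: ler_pM => //; exact: ltW.
Qed.

Lemma attach_prob01 i : 0 <= attach_prob mu E i <= 1.
Proof.
apply/andP; split; last by rewrite ge_min lexx orbT.
by rewrite attach_probE mulr_ge0 // divr_ge0 ?mulr_ge0 // ltW.
Qed.

Lemma sum_attach_prob : \sum_i attach_prob mu E i = mu.
Proof.
under eq_bigr do rewrite attach_probE.
by rewrite -mulr_sumr handshakeR; field; exact: lt0r_neq0.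
Qed.

Lemma sum_attach_prob_degree :
  \sum_i attach_prob mu E i * (degree E i)%:R = mu / 2 * (Q / e).
Proof.
under eq_bigr do rewrite attach_probE -mulrA -expr2.
by rewrite -mulr_sumr -sqr_degreeE; field; exact: lt0r_neq0.
Qed.

Lemma sum_attach_prob_sqr :
  \sum_i attach_prob mu E i ^+ 2 = mu ^+ 2 / 4 * (Q * v ^+ 4).
Proof.
under eq_bigr do rewrite attach_probE exprMn.
have -> : v ^+ 4 = (v ^+ 2) ^+ 2 by rewrite -exprM.
by rewrite -mulr_sumr -sqr_degreeE inv_sqrt_edges_sqr -/e; field; exact: lt0r_neq0.
Qed.

Lemma subset_prob_isolated (S : {set 'I_n}) :
  ~~ (S \subset nonisolated E) -> subset_prob (attach_prob mu E) S = 0.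
Proof.
case/fintype.subsetPn=> i iS; rewrite inE -eqn0Ngt => /eqP di.
by rewrite /subset_prob (bigD1 i) //= iS attach_probE di mulr0 mul0r.
Qed.

Lemma subset_prob_set0E : subset_prob p finset.set0 = \prod_i (1 - p i).
Proof. by apply: eq_bigr => i _; rewrite inE. Qed.

(** The new vertex receives an edge with probability at least
    1 - exp (- mu), which is bounded below linearly in mu on [0, 2]. *)
Lemma subset_prob_set0_le : subset_prob p finset.set0 <= 1 - mu / 3.
Proof.
rewrite subset_prob_set0E.
apply: (le_trans (prod_onem_le_expR _ attach_prob01)); rewrite sum_attach_prob.
apply: (le_trans (expRN_le_inv (ltW mu_gt0))).
rewrite -[leLHS]mul1r ler_pdivrMr ?ltr_pwDl ?(ltW mu_gt0) // -subr_ge0.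
have -> : (1 - mu / 3) * (1 + mu) - 1 = mu * (2 - mu) / 3 by field.
by rewrite divr_ge0 // mulr_ge0 ?subr_ge0 // ltW.
Qed.

(** The right-hand side is linear in |S|, |S|^2, the sum of the degrees over S, and
    the indicator of S = set0, whose means are all under control.  The negative
    power of e + |S| is expanded where it multiplies Q, and replaced by that of
    e where it multiplies the increment of Q. *)
Lemma potential_add_vertex_le (S : {set 'I_n}) :
  potential (add_vertex E S) <=
    (Q * v ^+ 3 + 264 * v - 66 * v ^+ 3)
    + (v ^+ 3 - 3 / 2 * (Q / e) * v ^+ 3) * #|S|%:R
    + (3 * (Q / e ^+ 2) * v ^+ 3 + v ^+ 3) * #|S|%:R ^+ 2
    + 2 * v ^+ 3 * (\sum_(i in S) (degree E i)%:R)
    + 66 * v ^+ 3 * (S == finset.set0)%:R.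
Proof.
set N : R := #|S|%:R; set D := \sum_(i in S) _.
have N0 : 0 <= N by exact: ler0n.
have D0 : 0 <= D by apply: sumr_ge0.
have v0 : 0 <= v by exact: inv_sqrt_edges_ge0.
have v30 : 0 <= v ^+ 3 by exact: exprn_ge0.
have Q0 : 0 <= Q by exact: sum_sqr_degree_ge0.
have QE : sum_sqr_degree (add_vertex E S) = Q + (2 * D + N) + N ^+ 2.
  rewrite /sum_sqr_degree sum_degree_sqr_add_vertex !natrD natrX.
  congr (_ + _ + _); rewrite natr_sum.
  under eq_bigr do rewrite natrD natrM.
  by rewrite big_split /= -mulr_sumr sumr_const.
set v' := inv_sqrt_edges (add_vertex E S).
have v'E : v' = (Num.sqrt (e + N))^-1 by rewrite /v' /inv_sqrt_edges card_add_vertex natrD.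
have v'_ge0 : 0 <= v' by exact: inv_sqrt_edges_ge0.
have v'v : v' <= v - v ^+ 3 / 4 + v ^+ 3 / 4 * (S == finset.set0)%:R.
  have [S0|] := eqVneq S finset.set0.
    by rewrite mulr1 subrK v'E /N S0 cards0 addr0.
  rewrite mulr0 addr0 -card_gt0 v'E => S0.
  by apply: invr_sqrt_add_le => //; rewrite ler1n.
have v'v3 : v' ^+ 3 <= v ^+ 3 * (1 - 3 / 2 * (N / e) + 3 * (N / e) ^+ 2).
  by rewrite v'E; apply: invr_sqrt3_add_le.
have v'v3' : v' ^+ 3 <= v ^+ 3.
  apply: lerXn2r; rewrite ?nnegrE //; rewrite v'E lef_pV2 ?posrE ?sqrtr_gt0 //.
    by rewrite ler_wsqrtr // lerDl.
  by rewrite ltr_wpDr.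
rewrite /potential QE -/v' -addrA mulrDl.
have H1 := ler_wpM2l Q0 v'v3.
have H2 : (2 * D + N + N ^+ 2) * v' ^+ 3 <= (2 * D + N + N ^+ 2) * v ^+ 3.
  by apply: ler_wpM2l => //; rewrite !addr_ge0 ?exprn_ge0 // mulr_ge0.
have E1 : Q * (v ^+ 3 * (1 - 3 / 2 * (N / e) + 3 * (N / e) ^+ 2)) =
   Q * v ^+ 3 - 3 / 2 * (Q / e) * v ^+ 3 * N + 3 * (Q / e ^+ 2) * v ^+ 3 * N ^+ 2 by field; exact: lt0r_neq0.
rewrite E1 in H1.
lra.
Qed.

(** In units of mu v^3, with v = e^(-1/2), the main terms are - 3/2 from the decay
    of e^(-3/2) and + 1 from the growth of Q, both times Q / e: this leaves - 1/2.
    The remaining terms amount to at most 1 + 3 + 9 Q / e^2 <= 22, which the decay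
    of 264 v, namely 264 / 12 = 22, compensates. *)
Lemma potential_drift :
  \sum_S subset_prob p S * potential (add_vertex E S) <=
  potential E - mu / 2 * (Q * v ^+ 5).
Proof.
have v0 : 0 <= v by exact: inv_sqrt_edges_ge0.
have v30 : 0 <= v ^+ 3 by exact: exprn_ge0.
have Q0 : 0 <= Q by exact: sum_sqr_degree_ge0.
have Qe : Q / e ^+ 2 <= 2.
  rewrite ler_pdivrMr ?exprn_gt0 // /Q /sum_sqr_degree -natrX -natrM ler_nat.
  exact: sum_degree_sqr_le.
have p01 := attach_prob01.
have -> : v ^+ 5 = v ^+ 3 / e by rewrite (exprD _ 3 2) inv_sqrt_edges_sqr.
apply: le_trans.
  by apply: ler_sum => S _; apply: ler_wpM2l (potential_add_vertex_le S);
     apply: subset_prob_ge0.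
set A := _ - 66 * _; set B := (v ^+ 3 - _); set C := 3 * _ * _ + _.
set D2 := 2 * _; set F := 66 * _.
have -> : \sum_S subset_prob p S * (A + B * #|S|%:R + C * #|S|%:R ^+ 2
      + D2 * (\sum_(i in S) (degree E i)%:R) + F * (S == finset.set0)%:R) =
    A * (\sum_S subset_prob p S) + B * (\sum_S subset_prob p S * #|S|%:R)
    + C * (\sum_S subset_prob p S * #|S|%:R ^+ 2)
    + D2 * (\sum_S subset_prob p S * \sum_(i in S) (degree E i)%:R)
    + F * (\sum_S subset_prob p S * (S == finset.set0)%:R).
  by rewrite !mulr_sumr -!big_split; apply: eq_bigr => S _ /=; ring.
rewrite sum_subset_prob mean_subset_card mean_subset_sum.
have -> : \sum_S subset_prob p S * (S == finset.set0)%:R = subset_prob p finset.set0.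
  rewrite (bigD1 finset.set0) //= eqxx mulr1 big1 ?addr0 // => S /negbTE ->.
  by rewrite mulr0.
rewrite sum_attach_prob sum_attach_prob_degree.
have m2 : \sum_S subset_prob p S * #|S|%:R ^+ 2 <= 3 * mu.
  apply: (le_trans (mean_subset_card_sqr p01)); rewrite sum_attach_prob.
  have : mu ^+ 2 <= 2 * mu by rewrite expr2 ler_wpM2r // ltW.
  by lra.
have C0 : 0 <= C.
  by rewrite addr_ge0 // !mulr_ge0 // invr_ge0 exprn_ge0 // ltW.
have HC := ler_wpM2l C0 m2.
have HF := ler_wpM2l v30 subset_prob_set0_le.
have HY := ler_wpM2l (mulr_ge0 (ltW mu_gt0) v30) Qe.
rewrite /potential -/Q -/v; rewrite /A /B /D2 /F; rewrite /C in HC *.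
set X := Q / e in HC *; set Y := Q / e ^+ 2 in HC HY *.
have -> : Q * (v ^+ 3 / e) = X * v ^+ 3 by rewrite /X mulrA mulrAC.
lra.
Qed.

Lemma abs_isolation_prob_le :
  `|subset_prob p finset.set0 - expR (- mu)| <= mu ^+ 2 / 4 * (Q * v ^+ 4).
Proof.
rewrite subset_prob_set0E -sum_attach_prob_sqr distrC ger0_norm.
  have := expR_sub_prod_onem_le (index_enum _) attach_prob01.
  by rewrite sum_attach_prob.
have := prod_onem_le_expR (index_enum _) attach_prob01.
by rewrite sum_attach_prob subr_ge0.
Qed.

End Drift.

(** * The law of the process *)

Section Process.
Local Open Scope classical_set_scope.
Context {R : realType} {d : measure_display} {T : measurableType d}.
Variables (P : probability T R) (mu : R) (G : forall t : nat, T -> graph t.+1).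

Lemma integral_weighted_indic (I : finType) (A : I -> set T) (c : I -> R)
    (X : T -> R) :
  (forall i, measurable (A i)) -> (forall i, 0 <= c i) ->
  (forall w, X w = \sum_i c i * \1_(A i) w) ->
  (\int[P]_w (X w)%:E = (\sum_i c i * fine (P (A i)))%:E)%E.
Proof.
move=> mA c0 XE.
under eq_integral do rewrite XE -sumEFin.
rewrite ge0_integral_sum //; last 2 first.
- move=> i; apply/measurable_EFinP/measurable_funM => //.
- by move=> i w _; rewrite lee_fin mulr_ge0.
rewrite -sumEFin; apply: eq_bigr => i _.
under eq_integral do rewrite EFinM.
rewrite ge0_integralZl_EFin //; last exact/measurable_EFinP.
by rewrite integral_indic // setIT EFinM fineK // fin_num_measure.
Qed.

Hypothesis hG : graph_process P mu G.

Definition law t (E : graph t.+1) : R := fine (P [set w | G t w = E]).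

Definition mean t (f : graph t.+1 -> R) : R := \sum_E f E * law E.

Lemma law_ge0 t (E : graph t.+1) : 0 <= law E.
Proof. exact/fine_ge0/measure_ge0. Qed.

Lemma integral_meanE t (f : graph t.+1 -> R) : (0 < t)%N ->
  (forall E, 0 <= f E) -> (\int[P]_w (f (G t w))%:E = (mean f)%:E)%E.
Proof.
move=> t0 f0.
apply: (integral_weighted_indic (A := fun E => [set w | G t w = E])) => //.
  by move=> E; exact (graph_process_measurable hG E t0).
move=> w; rewrite (bigD1 (G t w)) //= indicE mem_set // mulr1 big1 ?addr0 //.
by move=> E /eqP nE; rewrite indicE memNset ?mulr0 // => /esym.
Qed.

Definition one_step_mean n (f : graph n.+1 -> R) (E : graph n) : R :=
  \sum_S subset_prob (attach_prob mu E) S * f (add_vertex E S).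

(** Both sides are the integral of f (G t.+1 w): the events on which G t and the
    neighbourhood of the new vertex are prescribed partition the space, because
    [add_vertex] is injective in the neighbourhood. *)
Lemma mean_step t (f : graph t.+2 -> R) : (0 < t)%N -> (forall E, 0 <= f E) ->
  mean f = mean (one_step_mean f).
Proof.
move=> t0 f0; apply: EFin_inj; rewrite -integral_meanE //.
pose A (ES : graph t.+1 * {set 'I_t.+1}) :=
  [set w | G t w = ES.1] `&` [set w | G t.+1 w = add_vertex ES.1 ES.2].
have mG s E : (0 < s)%N -> measurable [set w | G s w = E].
  by move=> s0; exact (graph_process_measurable hG E s0).
have PA E S : fine (P (A (E, S))) = law E * subset_prob (attach_prob mu E) S.
  have := graph_process_law hG E S t0.
  rewrite -/(A (E, S)) /= => ->; rewrite -[P _]fineK ?fin_num_measure //.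
  exact: mG.
rewrite (integral_weighted_indic (A := A)
  (c := fun ES => f (add_vertex ES.1 ES.2))) //.
- congr (_%:E); rewrite /mean.
  transitivity (\sum_E \sum_S f (add_vertex E S) * fine (P (A (E, S)))).
    by rewrite pair_bigA.
  apply: eq_bigr => E _; rewrite mulr_suml; apply: eq_bigr => S _.
  by rewrite PA; ring.
- by move=> [E S]; apply: measurableI; apply: mG.
move=> w; have [S GS] := graph_process_step hG w t0.
rewrite (bigD1 (G t w, S)) //= indicE mem_set // mulr1 -GS big1 ?addr0 //.
move=> [E S'] /= nES; rewrite indicE memNset ?mulr0 //= => -[/= EG].
rewrite GS EG => /add_vertex_inj SS'; move: nES; rewrite SS' EG.
by rewrite eqxx.
Qed.

Lemma mean_start (f : graph 2 -> R) : mean (t := 1) f = f single_edge.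
Proof.
have law1 E : law (t := 1) E = (E == single_edge)%:R.
  rewrite /law; have [->|/eqP nE] := eqVneq E single_edge.
    have -> : [set w | G 1 w = single_edge] = setT.
      by apply/seteqP; split=> // w _; exact: graph_process_start hG w.
    by rewrite probability_setT.
  have -> : [set w | G 1 w = E] = set0.
    apply/seteqP; split=> // w /= EG; apply: nE.
    by rewrite -EG (graph_process_start hG).
  by rewrite measure0.
rewrite /mean (bigD1 single_edge) //= law1 eqxx mulr1 big1 ?addr0 // => E.
by rewrite law1 => /negbTE ->; rewrite mulr0.
Qed.

Lemma mean_cst t (c : R) : mean (t := t.+1) (fun=> c) = c.
Proof.
suff mean1 : mean (t := t.+1) (fun=> 1) = 1.
  rewrite -[RHS]mulr1 -[in RHS]mean1 /mean mulr_sumr.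
  by apply: eq_bigr => E _; rewrite mul1r.
elim: t => [|t IHt]; first by rewrite mean_start.
rewrite mean_step // -[RHS]IHt; apply: eq_bigr => E _; congr (_ * _).
rewrite /one_step_mean -[RHS](sum_subset_prob (attach_prob mu E)).
by apply: eq_bigr => S _; rewrite mulr1.
Qed.

Lemma meanD t (f g : graph t.+1 -> R) :
  mean (fun E => f E + g E) = mean f + mean g.
Proof. by rewrite -big_split; apply: eq_bigr => E _; rewrite mulrDl. Qed.

Lemma meanZ t (c : R) (f : graph t.+1 -> R) :
  mean (fun E => c * f E) = c * mean f.
Proof. by rewrite /mean mulr_sumr; apply: eq_bigr => E _; rewrite mulrA. Qed.

Lemma mean_ge0 t (f : graph t.+1 -> R) : (forall E, 0 <= f E) -> 0 <= mean f.
Proof. by move=> f0; apply: sumr_ge0 => E _; rewrite mulr_ge0 ?law_ge0. Qed.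

Hypotheses (mu_gt0 : 0 < mu) (mu_le2 : mu <= 2).

(** The mean of the indicator of the graphs that are not grown vanishes at every
    time, since sets S that meet the isolated vertices have weight zero. *)
Lemma grown_graph_as t (E : graph t.+2) : law E != 0 -> grown_graph E.
Proof.
pose bad n (F : graph n) : R := (~~ `[< grown_graph F >])%:R.
have bad0 n (F : graph n) : 0 <= bad n F by exact: ler0n.
have badP n (F : graph n) : grown_graph F -> bad n F = 0.
  by rewrite /bad => gF; rewrite asboolT.
suff mean_bad : mean (bad t.+2) = 0.
  apply: contraNP => nE; have := psumr_eq0P _ mean_bad.
  move=> /(_ (fun F _ => mulr_ge0 (bad0 _ F) (law_ge0 F)))/(_ E isT)/eqP.
  by rewrite /bad asboolF // mul1r.
elim: t {E} => [|t IHt]; first by rewrite mean_start badP //; exact: grown_single_edge.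
rewrite mean_step // [LHS]big1 // => E _.
have := psumr_eq0P _ IHt.
move=> /(_ (fun F _ => mulr_ge0 (bad0 _ F) (law_ge0 F)))/(_ E isT)/eqP.
rewrite mulf_eq0 => /orP[|/eqP ->]; last by rewrite mulr0.
rewrite /bad pnatr_eq0 eqb0 negbK => /asboolP gE.
rewrite [one_step_mean _ _]big1 ?mul0r // => S _.
have [SE|SE] := boolP (S \subset nonisolated E).
  by rewrite asboolT ?mulr0 //; exact: grown_add_vertex.
by rewrite subset_prob_isolated ?mul0r.
Qed.

Lemma mean_le t (f g : graph t.+2 -> R) :
  (forall E, grown_graph E -> f E <= g E) -> mean f <= mean g.
Proof.
move=> fg; apply: ler_sum => E _.
have [->|/grown_graph_as gE] := eqVneq (law E) 0; first by rewrite !mulr0.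
by rewrite ler_wpM2r ?law_ge0 ?fg.
Qed.

Lemma eq_mean t (f g : graph t.+2 -> R) :
  (forall E, grown_graph E -> f E = g E) -> mean f = mean g.
Proof. by move=> fg; apply: le_anti; rewrite !mean_le // => E /fg ->. Qed.

(** * Bounds summed over time *)

(** The mean of Q e^(- k / 2), the exponents 5, 4 and 3 being those of the gain, of
    the error of one step, and of the potential. *)
Definition mean_sqr_degree (k t : nat) : R :=
  mean (t := t) (fun E => sum_sqr_degree R E * inv_sqrt_edges R E ^+ k).

Lemma potential_single_edge : potential R single_edge = 266.
Proof.
have e1 : inv_sqrt_edges R single_edge = 1.
  by rewrite /inv_sqrt_edges cards1 sqrtr1 invr1.
rewrite /potential e1 expr1n !mulr1 /sum_sqr_degree.
under eq_bigr do rewrite degree_single_edge.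
by rewrite sum_nat_const card_ord -natrD.
Qed.

(** The drift inequality summed over time; 266 is the potential of the starting
    graph, for which Q = 2 and e = 1. *)
Lemma mean_potential_le m :
  mean (t := m.+1) (@potential R _) +
    mu / 2 * (\sum_(k < m) mean_sqr_degree 5 k.+1) <= 266.
Proof.
elim: m => [|m IHm].
  by rewrite big_ord0 mulr0 addr0 mean_start potential_single_edge.
apply: le_trans IHm; rewrite big_ord_recr /= mulrDr addrCA [leRHS]addrC lerD2l.
rewrite mean_step //; last exact: potential_ge0.
rewrite -lerBrDr -mulNr -meanZ -meanD; apply: mean_le => E gE.
by rewrite mulNr; exact: potential_drift.
Qed.

Lemma sum_mean_sqr_degree5_le m : mu / 2 * (\sum_(k < m) mean_sqr_degree 5 k.+1) <= 266.
Proof.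
apply: le_trans (mean_potential_le m); rewrite lerDr.
by apply: mean_ge0 => E; exact: potential_ge0.
Qed.

Lemma mean_sqr_degree3_le m : mean_sqr_degree 3 m.+1 <= 266.
Proof.
apply: (@le_trans _ _ (mean (t := m.+1) (@potential R _))).
  by apply: mean_le => E _; rewrite lerDl mulr_ge0 ?ler0n ?inv_sqrt_edges_ge0.
apply: le_trans (mean_potential_le m); rewrite lerDl mulr_ge0 //.
  by rewrite divr_ge0 // ltW.
apply: sumr_ge0 => k _; apply: mean_ge0 => E.
by rewrite mulr_ge0 ?exprn_ge0 ?inv_sqrt_edges_ge0 ?sum_sqr_degree_ge0.
Qed.

(** The inequality of arithmetic and geometric means, with a weight s that is later
    the square root of the final time. *)
Lemma mean_sqr_degree4_le s t : 0 < s ->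
  mean_sqr_degree 4 t.+1 <=
    s * mean_sqr_degree 5 t.+1 + s^-1 * mean_sqr_degree 3 t.+1.
Proof.
move=> s0; rewrite -!meanZ -meanD; apply: mean_le => E _.
have Q0 := sum_sqr_degree_ge0 R E; have v0 := inv_sqrt_edges_ge0 R E.
move: (sum_sqr_degree _ _) (inv_sqrt_edges _ _) Q0 v0 => Q v Q0 v0.
rewrite -subr_ge0.
have -> : s * (Q * v ^+ 5) + s^-1 * (Q * v ^+ 3) - Q * v ^+ 4 =
    Q * v ^+ 3 / s * ((s * v - 1) ^+ 2 + s * v).
  by field; exact: lt0r_neq0.
by rewrite mulr_ge0 ?addr_ge0 ?sqr_ge0 // ?mulr_ge0 ?invr_ge0 ?exprn_ge0 // ltW.
Qed.

Definition mean_giant_size (t : nat) := mean (t := t) (fun E => #|giant E|%:R).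

Lemma one_step_mean_giant_size n (E : graph n) : grown_graph E ->
  one_step_mean (fun F => #|giant F|%:R) E =
  #|giant E|%:R + 1 - subset_prob (attach_prob mu E) finset.set0.
Proof.
move=> gE; set a : R := #|giant E|%:R; pose q := subset_prob (attach_prob mu E).
transitivity (\sum_S ((a + 1) * q S - q S * (S == finset.set0)%:R)).
  apply: eq_bigr => S _; rewrite -/(q S).
  have [SE|SE] := boolP (S \subset nonisolated E); last first.
    by rewrite /q subset_prob_isolated // mulr0 !mul0r subr0.
  rewrite (giant_nonisolated (grown_add_vertex gE SE)).
  rewrite card_nonisolated_add_vertex // natrD -(giant_nonisolated gE) -/a.
  by case: (S == finset.set0) => /=; ring.
rewrite sumrB -mulr_sumr sum_subset_prob mulr1; congr (_ - _).
rewrite (bigD1 finset.set0) //= eqxx mulr1 big1 ?addr0 // => S /negbTE ->.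
by rewrite mulr0.
Qed.

Lemma mean_giant_size_step t :
  `|mean_giant_size t.+2 - mean_giant_size t.+1 - (1 - expR (- mu))|
    <= mu ^+ 2 / 4 * mean_sqr_degree 4 t.+1.
Proof.
pose iso n (E : graph n) := subset_prob (attach_prob mu E) finset.set0.
have -> : mean_giant_size t.+2 =
    mean (t := t.+1) (fun E => #|giant E|%:R + (1 + -1 * iso _ E)).
  rewrite /mean_giant_size mean_step //; apply: eq_mean => E gE.
  by rewrite one_step_mean_giant_size // mulN1r addrA.
rewrite !meanD mean_cst meanZ.
have -> : mean_giant_size t.+1 + (1 + -1 * mean (iso t.+2)) - mean_giant_size t.+1
    - (1 - expR (- mu)) = expR (- mu) - mean (iso t.+2) by ring.
rewrite -[X in `|X - _|](mean_cst t) -meanZ ler_norml.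
rewrite -mulN1r -meanZ lerBlDr lerBrDl -!meanD.
by apply/andP; split; apply: mean_le => E gE;
  have := abs_isolation_prob_le mu_gt0 mu_le2 gE; rewrite ler_norml -/(iso _ E); lra.
Qed.

Lemma mean_giant_size_approx m :
  `|mean_giant_size m.+1 - 2 - (1 - expR (- mu)) * m%:R|
    <= mu ^+ 2 / 4 * (\sum_(k < m) mean_sqr_degree 4 k.+1).
Proof.
elim: m => [|m IHm].
  rewrite big_ord0 !mulr0 subr0 /mean_giant_size mean_start.
  rewrite (giant_nonisolated grown_single_edge) nonisolated_single_edge cardsT card_ord.
  by rewrite subrr normr0.
rewrite big_ord_recr /= mulrDr; apply: le_trans (lerD IHm (mean_giant_size_step m)).
apply: le_trans (ler_normD _ _); rewrite le_eqVlt; apply/orP; left; apply/eqP.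
by congr (`| _ |); rewrite -natr1; ring.
Qed.

(** With s = sqrt t, the sum of the terms Q e^(-5/2) contributes
    mu^2 / 4 * 532 s / mu <= 266 s and the terms Q e^(-3/2) contribute
    mu^2 / 4 * 266 s <= 266 s.  The remaining 3 s covers the two initial
    vertices and the shift from t - 1 steps to t. *)
Lemma mean_giant_size_error t : (0 < t)%N ->
  `|mean_giant_size t - (1 - expR (- mu)) * t%:R| <= 535 * Num.sqrt t%:R.
Proof.
case: t => // m _; set s : R := Num.sqrt _.
have s2 : s ^+ 2 = m.+1%:R by rewrite sqr_sqrtr.
have s1 : 1 <= s by rewrite -[leLHS]sqrtr1 ler_wsqrtr // ler1n.
have s0 : 0 < s by exact: lt_le_trans s1.
have sum4 : \sum_(k < m) mean_sqr_degree 4 k.+1 <=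
    s * (\sum_(k < m) mean_sqr_degree 5 k.+1) + 266 * s.
  apply: (@le_trans _ _ (\sum_(k < m) (s * mean_sqr_degree 5 k.+1 + s^-1 * 266))).
    apply: ler_sum => k _; apply: (le_trans (mean_sqr_degree4_le k s0)).
    by rewrite lerD2l ler_wpM2l ?invr_ge0 ?(ltW s0) // mean_sqr_degree3_le.
  rewrite big_split /= mulr_sumr lerD2l sumr_const card_ord -[_ *+ m]mulr_natr.
  have -> : s^-1 * 266 * m%:R = 266 * (m%:R / s) by ring.
  by rewrite ler_wpM2l ?ler0n // ler_pdivrMr // -expr2 s2 ler_nat leqnSn.
have := mean_giant_size_approx m; have := sum_mean_sqr_degree5_le m.
set S5 := \sum_(k < m) mean_sqr_degree 5 _ in sum4 *.
set S4 := \sum_(k < m) mean_sqr_degree 4 _ in sum4 *.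
move=> S5le approx.
have mu20 : 0 <= mu ^+ 2 / 4 by rewrite divr_ge0 ?sqr_ge0.
have S4le : mu ^+ 2 / 4 * S4 <= 532 * s.
  apply: (le_trans (ler_wpM2l mu20 sum4)).
  have H1 : mu * s * (mu / 2 * S5) <= mu * s * 266.
    by rewrite ler_wpM2l // mulr_ge0 // ltW.
  have H2 : mu * s <= 2 * s by rewrite ler_wpM2r // ltW.
  have H3 : mu * (mu * s) <= 2 * (2 * s).
    by apply: ler_pM => //; rewrite ?mulr_ge0 // ltW.
  lra.
have E01 : 0 <= 1 - expR (- mu) <= 1.
  have := expR_ge0 (- mu); have : expR (- mu) <= 1.
    by rewrite -expR0 ler_expR oppr_le0 ltW.
  by lra.
move: approx; rewrite -natr1 !ler_norml; lra.
Qed.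

End Process.

Theorem theorem1p2 (R : realType) :
  exists2 nu0 : R, 0 < nu0 &
    forall nu : R, 0 < nu < nu0 ->
    exists C : R,
      forall mu : R, 0 < mu <= 2 ->
      forall (d : measure_display) (T : measurableType d) (P : probability T R)
             (G : forall t : nat, T -> graph t.+1),
      graph_process P mu G ->
      forall t : nat, (1 <= t)%N ->
        (`| 'E_P[fun w => #|giant (G t w)|%:R] - ((1 - expR (- mu)) * t%:R)%:E |
          <= (C * t%:R `^ (2 - nu)^-1)%:E)%E.
Proof.
exists 1 => // nu /andP[nu0 nu1]; exists 535 => mu /andP[mu0 mu2] d T P G hG t t1.
rewrite unlock (integral_meanE hG (f := fun E => #|giant E|%:R)) //.
rewrite -EFinB lee_fin.
apply: (le_trans (mean_giant_size_error hG mu0 mu2 t1)).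
rewrite ler_wpM2l ?ler0n // -powR12_sqrt ?ler0n // ler_powR ?ler1n // lef_pV2 ?posrE; lra.
Qed.
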